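(* Let $n\ge 1$ and let $\alpha=(\alpha_1,\dots,\alpha_\ell)$ be a composition of $n$, with partial sums $s_j=\alpha_1+\dots+\alpha_j$ for $1\le j\le \ell$. Let $N(\alpha):=\#\{w\in\mathcal{A}_{2n} : \operatorname{rc}(\hat w)=\alpha\}$ be the number of alternating permutations of $[2n]$ with record composition $\alpha$, let $b_k:=\dfrac{k\,E_{2k-1}}{(2k)!}$ for $k\ge 1$, and let $\pi_u(\alpha):=\prod_{j=1}^{\ell}s_j$. Then $$N(\alpha)=(2n)!\,\prod_{j=1}^{\ell}\frac{b_{\alpha_j}}{s_j}=(2n)!\,\frac{b_{\alpha_1}b_{\alpha_2}\cdots b_{\alpha_\ell}}{\pi_u(\alpha)}.$$
   Context: $[m]=\{1,\dots,m\}$. A composition of $n$ is a finite sequence of positive integers with sum $n$. A permutation $w=a_1a_2\dots a_m$ of $[m]$ in one-line notation is alternating if $a_1>a_2<a_3>a_4<\cdots$, that is, $a_i>a_{i+1}$ for odd $i$ and $a_i<a_{i+1}$ for even $i$ ($1\le i\le m-1$). $\mathcal{A}_{2n}$ is the set of alternating permutations of $[2n]$. The Euler number $E_k$ is the number of alternating permutations of $[k]$, with $E_0=1$; equivalently $\sec t+\tan t=\sum_{k\ge 0}E_k t^k/k!$. For $w=a_1a_2\dots a_{2n}\in\mathcal{A}_{2n}$, let $\hat w=b_1'b_2'\dots b_n'$ with $b_i'=a_{2i-1}$. An index $i\in[n]$ is a record position of $\hat w$ if $b_i'>b_j'$ for all $1\le j<i$ (so $1$ is always a record position). If $r_1=1<r_2<\dots<r_\ell$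 are all the record positions of $\hat w$ and $r_{\ell+1}:=n+1$, the record composition of $\hat w$ is $\operatorname{rc}(\hat w):=(r_2-r_1,\,r_3-r_2,\dots,\,r_{\ell+1}-r_\ell)$, a composition of $n$. *)

(* Defs.v *)
From HB Require Import structures.
From mathcomp Require Import all_boot all_order all_fingroup all_algebra.

Set Implicit Arguments.
Unset Strict Implicit.
Unset Printing Implicit Defensive.

Import GRing.Theory.

(* Words, compositions and their positions are indexed from 1; the index 0 is
   never used, and positions past the end of the word give 0. *)
Definition entry (s : seq nat) (i : nat) : nat := nth 0 s i.-1.

(* 'S_m permutes {0, ..., m-1}; both positions and values are shifted by 1, so
   that [oneline w] is a word in {1, ..., m}. *)
Definition oneline (m : nat) (w : 'S_m) : seq nat :=
  [seq (val (w i)).+1 | i <- enum 'I_m].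

Definition alternating (m : nat) (w : 'S_m) : bool :=
  all (fun i => if odd i then entry (oneline w) i > entry (oneline w) i.+1
                else entry (oneline w) i < entry (oneline w) i.+1)
      (iota 1 m.-1).

Definition alt_perms (m : nat) : {set 'S_m} := [set w | alternating w].

Definition euler (k : nat) : nat := #|alt_perms k|.

(* The convention E_0 = 1 is what the general definition gives. *)
Lemma euler0 : euler 0 = 1.
Proof.
rewrite /euler; have -> : alt_perms 0 = setT by apply/setP=> w; rewrite !inE.
by rewrite cardsT card_Sn.
Qed.

Definition hat (n : nat) (w : 'S_(2 * n)) : seq nat :=
  [seq entry (oneline w) (2 * i - 1) | i <- iota 1 n].

Definition record_position (s : seq nat) (i : nat) : bool :=
  all (fun j => entry s j < entry s i) (iota 1 i.-1).

Definition record_positions (s : seq nat) : seq nat :=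
  [seq i <- iota 1 (size s) | record_position s i].

Definition record_composition (s : seq nat) : seq nat :=
  let r := rcons (record_positions s) (size s).+1 in
  [seq entry r j.+1 - entry r j | j <- iota 1 (size (record_positions s))].

Definition is_composition (n : nat) (alpha : seq nat) : bool :=
  (sumn alpha == n) && all (fun k => 0 < k) alpha.

Definition num_alt_rc (n : nat) (alpha : seq nat) : nat :=
  #|[set w in alt_perms (2 * n) | record_composition (hat w) == alpha]|.

Definition partial_sum (alpha : seq nat) (j : nat) : nat :=
  \sum_(1 <= i < j.+1) entry alpha i.

Definition pi_u (alpha : seq nat) : nat :=
  \prod_(1 <= j < (size alpha).+1) partial_sum alpha j.

Definition bcoef (k : nat) : rat :=
  (k%:R * (euler (2 * k - 1))%:R / ((2 * k)`!)%:R)%R.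

(* Main.v *)
Require Import Defs.
From HB Require Import structures.
From mathcomp Require Import all_boot all_order all_fingroup all_algebra.
From mathcomp Require Import zify ring.

Set Implicit Arguments.
Unset Strict Implicit.
Unset Printing Implicit Defensive.

Import GRing.Theory.

(** Cut an alternating permutation w of [2n] at its maximum: w = p 2n q. The
    maximum can only sit at a peak, so p has even length 2m, and it is the last
    record among the peaks. Hence p is alternating, q is alternating with the
    opposite parity and has odd length 2k-1, where k = n-m is the last part of
    the record composition, and the other parts form the record composition of
    the peaks of p (zigzag_max, record_composition_max). Conversely, any such p
    and q give an alternating permutation.

    Being alternating and having a given record composition depend only on the
    relative order of the letters, so the choice of the set of values used by p
    and the choices of the patterns of p and q are independent
    (count_perms_max). Counting the patterns of q by complementation gives
      N(alpha_1, ..., alpha_l, k)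
        = binomial(2n-1, 2m) N(alpha_1, ..., alpha_l) E_{2k-1}
    (num_alt_rc_rcons), where m is the sum of the alpha_i. Since
      binomial(2n-1, 2m) = (2n)! / (2m)! * k / (n (2k)!),
    each step contributes the factor b_k / n, n being the last partial sum, and
    the product formula follows by induction on the number of parts. *)

(** * Counting permutations by order-invariant properties *)

(** Words with the same pattern: [order_invariant] properties are those of the
    standardization of a word. *)
Definition same_order (s t : seq nat) : Prop :=
  size s = size t /\
  forall i j, i < size s -> j < size s ->
    (nth 0 s i < nth 0 s j) = (nth 0 t i < nth 0 t j).

Definition order_invariant (P : pred (seq nat)) : Prop :=
  forall s t, same_order s t -> P s = P t.

Definition count_perms (N : nat) (P : pred (seq nat)) : nat :=
  #|[set w : 'S_N | P (oneline w)]|.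

Lemma size_map_ord N (f : 'I_N -> nat) : size [seq f i | i <- enum 'I_N] = N.
Proof. by rewrite size_map size_enum_ord. Qed.

Lemma size_oneline N (w : 'S_N) : size (oneline w) = N.
Proof. exact: size_map_ord. Qed.

Lemma nth_oneline N (w : 'S_N) (i : 'I_N) : nth 0 (oneline w) i = (w i).+1.
Proof. by rewrite (nth_map i) ?size_enum_ord // nth_ord_enum. Qed.

Lemma eq_count_perms N P Q :
  (forall w : 'S_N, P (oneline w) = Q (oneline w)) ->
  count_perms N P = count_perms N Q.
Proof. by move=> PQ; apply: eq_card => w; rewrite !inE PQ. Qed.

Lemma count_perms_sum N P :
  count_perms N P = \sum_(w : 'S_N) P (oneline w).
Proof.
rewrite /count_perms -sum1dep_card big_mkcond /=.
by apply: eq_bigr => w _; case: P.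
Qed.

Lemma same_order_map N (f g : 'I_N -> nat) :
  (forall i j, (f i < f j) = (g i < g j)) ->
  same_order [seq f i | i <- enum 'I_N] [seq g i | i <- enum 'I_N].
Proof.
move=> fg; rewrite /same_order !size_map_ord.
split=> // i j ltiN ltjN.
have nthE (h : 'I_N -> nat) k (ltkN : k < N) :
    nth 0 [seq h i | i <- enum 'I_N] k = h (Ordinal ltkN).
  rewrite (nth_map (Ordinal ltkN)) ?size_enum_ord //; congr h.
  by apply: val_inj; rewrite /= nth_enum_ord.
by rewrite !(nthE _ _ ltiN) !(nthE _ _ ltjN).
Qed.

(** Composing with the rank function of g, which is itself a permutation, turns
    the rearrangements of any word with distinct letters into the permutations
    of [N] with the same patterns. *)
Lemma sum_relabel N P (g : 'I_N -> nat) :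
  order_invariant P -> injective g ->
  \sum_(s : 'S_N) P [seq g (s i) | i <- enum 'I_N] = count_perms N P.
Proof.
move=> Pinv g_inj; pose rank i := #|[set j | g j < g i]|.
have rank_lt i : rank i < N.
  rewrite -[X in _ < X]card_ord -cardsT; apply: proper_card.
  by apply/properP; split=> //; exists i; rewrite !inE ?ltnn.
have rank_homo i j : g i < g j -> rank i < rank j.
  move=> ltij; apply/proper_card/properP; split.
    by apply/subsetP=> k; rewrite !inE => /ltn_trans; apply.
  by exists i; rewrite !inE ?ltnn.
have rank_mono i j : (rank i < rank j) = (g i < g j).
  apply/idP/idP=> [|/rank_homo//]; apply: contraTT; rewrite -!leqNgt leq_eqVlt.
  by case/predU1P=> [/g_inj->//|/rank_homo/ltnW].
have rho_inj : injective (fun i => Ordinal (rank_lt i)).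
  move=> i j /(congr1 val) /= eq_ij; apply: g_inj.
  have := rank_mono i j; have := rank_mono j i; rewrite eq_ij ltnn.
  by case: ltngtP.
rewrite count_perms_sum [RHS](reindex_inj (mulIg (perm rho_inj))) /=.
apply: eq_bigr => s _; congr (nat_of_bool _); apply/Pinv/same_order_map => i j.
by rewrite !permM !permE /= ltnS rank_mono.
Qed.

Lemma oneline_cat a b (w : 'S_(a + b)) :
  oneline w = [seq (w (lshift b i)).+1 | i <- enum 'I_a]
           ++ [seq (w (rshift a i)).+1 | i <- enum 'I_b].
Proof.
apply: (@eq_from_nth _ 0).
  by rewrite size_oneline size_cat !size_map_ord.
rewrite size_oneline => i lti; rewrite -[i]/(val (Ordinal lti)) nth_oneline.
rewrite nth_cat size_map_ord.
case: split_ordP => j -> /=.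
  by rewrite (nth_map j) ?size_enum_ord // nth_ord_enum.
by rewrite addKn (nth_map j) ?size_enum_ord // nth_ord_enum.
Qed.

(** The action of ['S_a * 'S_b] on positions that permutes the first a positions
    and the last b positions separately. *)
Definition block_fun a b (s : 'S_a) (t : 'S_b) (i : 'I_(a + b)) : 'I_(a + b) :=
  match split i with inl j => lshift b (s j) | inr j => rshift a (t j) end.

Lemma block_fun_inj a b (s : 'S_a) (t : 'S_b) : injective (block_fun s t).
Proof.
move=> i j; rewrite /block_fun.
case: split_ordP => i' ->; case: split_ordP => j' -> /eqP.
- by rewrite eq_lshift => /eqP/perm_inj->.
- by rewrite eq_lrshift.
- by rewrite eq_rlshift.
- by rewrite eq_rshift => /eqP/perm_inj->.
Qed.

Definition block_perm a b (s : 'S_a) (t : 'S_b) := perm (@block_fun_inj a b s t).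

Lemma oneline_block a b (s : 'S_a) (t : 'S_b) (w : 'S_(a + b)) :
  oneline (block_perm s t * w) =
    [seq (w (lshift b (s i))).+1 | i <- enum 'I_a]
      ++ [seq (w (rshift a (t i))).+1 | i <- enum 'I_b].
Proof.
rewrite oneline_cat; congr (_ ++ _); apply: eq_map => i;
  rewrite permM permE /block_fun.
  by rewrite (unsplitK (inl i)).
by rewrite (unsplitK (inr i)).
Qed.

(** Averaging over the action of ['S_a * 'S_b] on positions: composing with a
    block permutation is a bijection of ['S_(a + b)], while for a fixed w the
    block rearrangements of w realize every pair of patterns exactly once. So
    a! b! times the left side is (a + b)! times the product of both counts. *)
Lemma count_perms_cat a b P Q :
  order_invariant P -> order_invariant Q ->
  count_perms (a + b) (fun s => P (take a s) && Q (drop a s)) =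
    'C(a + b, a) * (count_perms a P * count_perms b Q).
Proof.
move=> Pinv Qinv; set R := fun s => _.
apply/eqP; rewrite -(@eqn_pmul2l (a`! * b`!)) ?muln_gt0 ?fact_gt0 //; apply/eqP.
rewrite mulnA [_ * 'C(_, _)]mulnC -[X in _ * X`!](addKn a b) bin_fact ?leq_addr //.
transitivity (\sum_(s : 'S_a) \sum_(t : 'S_b) count_perms (a + b) R).
  by rewrite !sum_nat_const !card_Sn addKn mulnA.
transitivity (\sum_(w : 'S_(a + b)) count_perms a P * count_perms b Q); last first.
  by rewrite sum_nat_const card_Sn.
transitivity (\sum_(w : 'S_(a + b)) \sum_(s : 'S_a) \sum_(t : 'S_b)
                R (oneline (block_perm s t * w))).
  rewrite [RHS]exchange_big; apply: eq_bigr => s _.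
  rewrite [RHS]exchange_big; apply: eq_bigr => t _.
  by rewrite count_perms_sum (reindex_inj (mulgI (block_perm s t))).
apply: eq_bigr => w _.
rewrite -(@sum_relabel a P (fun i => (w (lshift b i)).+1)) //; last first.
  by move=> i j [/val_inj/perm_inj/lshift_inj].
rewrite -(@sum_relabel b Q (fun i => (w (rshift a i)).+1)) //; last first.
  by move=> i j [/val_inj/perm_inj/rshift_inj].
rewrite big_distrl; apply: eq_bigr => s _; rewrite big_distrr.
apply: eq_bigr => t _; rewrite /R oneline_block.
have sz : size [seq (w (lshift b (s i))).+1 | i <- enum 'I_a] = a.
  by rewrite size_map size_enum_ord.
by rewrite -[X in take X]sz -[X in drop X]sz take_size_cat // drop_size_cat // -mulnb.
Qed.

(** * Cutting a permutation at its maximum *)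

Lemma lift_perm_surj N (i j : 'I_N.+1) (w : 'S_N.+1) :
  w i = j -> exists s : 'S_N, w = lift_perm i j s.
Proof.
move=> wi; pose f k := odflt k (unlift j (w (lift i k))).
have liftf k : lift j (f k) = w (lift i k).
  rewrite /f; case: (unliftP j (w (lift i k))) => [l -> //|].
  by rewrite -wi => /perm_inj/eqP; rewrite eq_sym (negPf (neq_lift i k)).
have f_inj : injective f.
  by move=> k l /(congr1 (lift j)); rewrite !liftf => /perm_inj/lift_inj.
exists (perm f_inj); apply/permP=> k; case: (unliftP i k) => [l ->|->].
  by rewrite lift_perm_lift permE liftf.
by rewrite lift_perm_id.
Qed.

Lemma lift_perm_inj N (i j : 'I_N.+1) : injective (@lift_perm N i j).
Proof.
move=> s t /permP st; apply/permP=> k; apply: (@lift_inj _ j).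
by rewrite -!(lift_perm_lift i) st.
Qed.

Lemma oneline_lift_max N (i : 'I_N.+1) (s : 'S_N) :
  oneline (lift_perm i ord_max s) =
    take i (oneline s) ++ N.+1 :: drop i (oneline s).
Proof.
have szt : size (take i (oneline s)) = i.
  by rewrite size_takel // size_oneline -ltnS.
apply: (@eq_from_nth _ 0).
  by rewrite size_cat /= addnS -size_cat cat_take_drop !size_oneline.
rewrite size_oneline => k ltk; rewrite -[k]/(val (Ordinal ltk)) nth_oneline.
rewrite nth_cat szt; case: (unliftP i (Ordinal ltk)) => [l ->|->].
  rewrite lift_perm_lift lift_max /= /bump.
  case: (leqP i l) => il.
    rewrite ltnNge (leq_trans il) //= add1n subSn //= nth_drop subnKC //.
    by rewrite nth_oneline.
  by rewrite add0n il nth_take // nth_oneline.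
by rewrite lift_perm_id ltnn subnn.
Qed.

(** Deleting the maximum from position a is a bijection onto ['S_(a + b)] that
    leaves the words on both sides of it unchanged. *)
Lemma count_perms_max a b P Q :
  order_invariant P -> order_invariant Q ->
  count_perms (a + b).+1 (fun s => [&& nth 0 s a == (a + b).+1,
                                       P (take a s) & Q (drop a.+1 s)]) =
    'C(a + b, a) * (count_perms a P * count_perms b Q).
Proof.
move=> Pinv Qinv; rewrite -count_perms_cat //.
have lta : a < (a + b).+1 by rewrite ltnS leq_addr.
pose i := Ordinal lta.
rewrite /count_perms -[RHS](card_imset _ (@lift_perm_inj _ i ord_max)).
have nthi (w : 'S_(a + b).+1) : nth 0 (oneline w) a = (w i).+1.
  exact: (nth_oneline w i).
have E (s : 'S_(a + b)) :
    (take a (oneline (lift_perm i ord_max s)) = take a (oneline s)) *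
    (drop a.+1 (oneline (lift_perm i ord_max s)) = drop a (oneline s)).
  rewrite oneline_lift_max /=.
  have sz : size (take a (oneline s)) = a.
    by rewrite size_takel // size_oneline leq_addr.
  split; first by rewrite take_size_cat.
  by rewrite -cat_rcons drop_size_cat // size_rcons sz.
apply: eq_card => w; rewrite inE; apply/idP/imsetP => [/and3P[]|[s]].
  rewrite nthi eqSS => /eqP wi.
  have /lift_perm_surj[s ->] : w i = ord_max by apply: val_inj.
  by rewrite !E => Ps Qs; exists s; rewrite // inE Ps.
rewrite inE => /andP[Ps Qs] ->.
by rewrite nthi lift_perm_id eqxx !E Ps.
Qed.


(** * Alternating words *)

(** With [d = false] the word starts with a descent, with [d = true] with an
    ascent. *)
Definition zigzag (d : bool) (s : seq nat) : bool :=
  all (fun i => if odd i (+) d then entry s i > entry s i.+1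
                else entry s i < entry s i.+1)
      (iota 1 (size s).-1).

Lemma zigzagP d s :
  reflect (forall i, i.+1 < size s ->
             if odd i (+) d then nth 0 s i < nth 0 s i.+1
             else nth 0 s i.+1 < nth 0 s i)
          (zigzag d s).
Proof.
apply: (iffP allP) => [zz i lti | zz [|i]]; rewrite ?mem_iota //.
  have := zz i.+1; rewrite mem_iota /entry /= add1n ltnS -ltnS prednK; last by case: s lti {zz}.
  by move=> /(_ lti); case: (odd i); case: d {zz}.
rewrite /= => lti; have := zz i; rewrite /entry /=.
have -> : i.+1 < size s by lia.
by move/(_ isT); case: (odd i); case: d {zz}.
Qed.

Lemma zigzag_same_order d : order_invariant (zigzag d).
Proof.
move=> s t [szE st]; apply/zigzagP/zigzagP => zz i lti; have := zz i.
  by rewrite -!st ?szE //; (lia || (apply; lia)).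
by rewrite !st -?szE //; (lia || (apply; lia)).
Qed.

Lemma zigzag_reverse d s t :
    size s = size t ->
    (forall i j, i < size s -> j < size s ->
       (nth 0 s i < nth 0 s j) = (nth 0 t j < nth 0 t i)) ->
  zigzag d s = zigzag (~~ d) t.
Proof.
move=> szE st; apply/zigzagP/zigzagP => zz i lti; have := zz i; rewrite addbN.
  by rewrite if_neg -!st ?szE //; (lia || (apply; lia)).
by rewrite if_neg !st -?szE //; (lia || (apply; lia)).
Qed.

(** The complement, which replaces each value by its mirror image, exchanges
    ascents and descents. *)
Lemma count_zigzag_true N : count_perms N (zigzag true) = euler N.
Proof.
have -> : euler N = count_perms N (zigzag false).
  by apply: eq_card => w; rewrite !inE /alternating /zigzag size_oneline;
    apply: eq_all => i; rewrite addbF.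
rewrite !count_perms_sum (reindex_inj (mulIg (perm (@rev_ord_inj N)))) /=.
apply: eq_bigr => w _; congr (nat_of_bool _).
apply: zigzag_reverse; rewrite !size_oneline // => i j lti ltj.
rewrite -[i]/(val (Ordinal lti)) -[j]/(val (Ordinal ltj)) !nth_oneline.
rewrite !permM !permE; case: (w (Ordinal lti)) => x ltx.
by case: (w (Ordinal ltj)) => y lty /=; lia.
Qed.

(** After an odd number of letters the alternation requires the next letter to
    lie in a valley, which the strict maximum cannot do; at a peak, both
    comparisons with the maximum hold automatically. *)
Lemma zigzag_max p M q :
  all (ltn^~ M) p -> all (ltn^~ M) q ->
  zigzag false (p ++ M :: q) =
    [&& ~~ odd (size p), zigzag false p & zigzag true q].
Proof.
move=> /(all_nthP 0) /= pM /(all_nthP 0) /= qM.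
have nthp i : i < size p -> nth 0 (p ++ M :: q) i = nth 0 p i.
  by move=> lti; rewrite nth_cat lti.
have nthM : nth 0 (p ++ M :: q) (size p) = M by rewrite nth_cat ltnn subnn.
have nthq i : nth 0 (p ++ M :: q) ((size p).+1 + i) = nth 0 q i.
  by rewrite addSnnS nth_cat ltnNge leq_addr addKn.
have oddMq i : ~~ odd (size p) -> odd ((size p).+1 + i) = ~~ odd i.
  by move=> evp; rewrite oddD oddS evp addTb.
apply/zigzagP/and3P => [zz | [evp /zigzagP zzp /zigzagP zzq] i].
  have evp : ~~ odd (size p).
    (* The letter just before M would have to exceed M. *)
    apply/negP=> oddp; have [i szp] : exists i, size p = i.+1.
      by exists (size p).-1; lia.
    have lti : i < size p by lia.
    have evi : odd i = false by move: oddp; rewrite szp /= => /negPf.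
    have := zz i; rewrite evi -szp nthM nthp // size_cat /=.
    by have := pM i lti; lia.
  split=> //; apply/zigzagP=> i lti.
    have := zz i; rewrite !nthp ?size_cat; [|lia..].
    by apply; lia.
  have := zz ((size p).+1 + i); rewrite -addnS !nthq oddMq // size_cat [size (M :: q)]/=.
  by rewrite addbF addbT; apply; lia.
rewrite size_cat /= addbF; case: (ltngtP i.+1 (size p)) => [lti _ | gti lti | eqi _].
- by rewrite !nthp; [|lia..]; have := zzp i lti; rewrite addbF.
- case: (ltngtP i (size p)) => [|gtp|eqp]; first lia.
    have [j defi] : exists j, i = (size p).+1 + j.
      by exists (i - (size p).+1); lia.
    rewrite defi -addnS !nthq oddMq //.
    by have := zzq j; rewrite addbT; apply; lia.
  rewrite eqp (negPf evp) nthM -[(size p).+1]addn0 nthq.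
  by have := qM 0; apply; lia.
have -> : odd i by move: evp; rewrite -eqi /= negbK.
by rewrite eqi nthM nthp; [apply: pM; lia | lia].
Qed.

(** * Peaks and records *)

(** [hat] on words of any length, so that it also applies to the factors of a
    word. *)
Definition peaks (s : seq nat) : seq nat :=
  [seq entry s (2 * i - 1) | i <- iota 1 (size s)./2].

Lemma size_peaks s : size (peaks s) = (size s)./2.
Proof. by rewrite size_map size_iota. Qed.

Lemma nth_peaks s i : i < (size s)./2 -> nth 0 (peaks s) i = nth 0 s (2 * i).
Proof.
move=> lti; rewrite (nth_map 0) ?size_iota // nth_iota // /entry.
by congr nth; lia.
Qed.

Lemma peaks_same_order s t : same_order s t -> same_order (peaks s) (peaks t).
Proof.
move=> [szE st]; split=> [|i j]; rewrite !size_peaks ?szE // => lti ltj.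
by rewrite !nth_peaks -?szE ?st; lia.
Qed.

Lemma peaks_max p M q :
  ~~ odd (size p) -> odd (size q) ->
  peaks (p ++ M :: q) =
    peaks p ++ M :: [seq nth 0 q i.*2.+1 | i <- iota 0 (size q)./2].
Proof.
move=> evp oddq; apply: (@eq_from_nth _ 0).
  rewrite size_peaks !size_cat /= size_peaks size_map size_iota; lia.
move=> i; rewrite size_peaks => lti; rewrite nth_peaks // !nth_cat size_peaks.
move: lti; rewrite size_cat /= => lti; case: ltnP => lip; case: ltnP => lip'; try lia.
  by rewrite nth_peaks.
have [j defi] : exists j, i = (size p)./2 + j by exists (i - (size p)./2); lia.
have -> : 2 * i - size p = j.*2 by lia.
rewrite defi addKn; case: j defi => [//|j] defi; rewrite doubleS /=.
by rewrite (nth_map 0) ?size_iota ?nth_iota ?add0n //; lia.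
Qed.


Lemma record_positions_same_order s t :
  same_order s t -> record_positions s = record_positions t.
Proof.
move=> [szE st]; rewrite /record_positions -szE.
apply: eq_in_filter => i; rewrite mem_iota => lei.
apply: eq_in_all => j; rewrite mem_iota => lej.
by rewrite /entry st; lia.
Qed.

Lemma record_composition_same_order s t :
  same_order s t -> record_composition s = record_composition t.
Proof.
move=> st; rewrite /record_composition (record_positions_same_order st).
by case: st => ->.
Qed.

(** A strict maximum is a record, hides every later letter from being one, and
    does not affect the records before it. *)
Lemma record_positions_max p M q :
  all (ltn^~ M) p -> all (ltn^~ M) q ->
  record_positions (p ++ M :: q) = rcons (record_positions p) (size p).+1.
Proof.
move=> /(all_nthP 0) /= pM /(all_nthP 0) /= qM.
rewrite /record_positions size_cat iotaD filter_cat /= add1n.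
have entryp i : 0 < i <= size p -> entry (p ++ M :: q) i = entry p i.
  by move=> lei; rewrite /entry nth_cat; case: ltnP => //; lia.
have entryM : entry (p ++ M :: q) (size p).+1 = M.
  by rewrite /entry nth_cat ltnn subnn.
have -> : record_position (p ++ M :: q) (size p).+1.
  apply/allP=> j; rewrite mem_iota entryM => lej.
  by rewrite entryp; [apply: pM | ]; lia.
rewrite -(cat_rcons (size p).+1) -[RHS]cats0; congr (rcons _ _ ++ _).
  apply: eq_in_filter => i; rewrite mem_iota => lei.
  apply: eq_in_all => j; rewrite mem_iota => lej.
  by rewrite !entryp; lia.
rewrite -(@filter_pred0 _ (iota (size p).+2 (size q))).
apply: eq_in_filter => i; rewrite mem_iota => lei.
apply/allPn; exists (size p).+1; first by rewrite mem_iota; lia.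
rewrite entryM -leqNgt /entry nth_cat; case: ltnP => [|_]; first lia.
have -> : i.-1 - size p = (i - (size p).+2).+1 by lia.
by apply: ltnW; apply: qM; lia.
Qed.

(** The last part runs from the maximum to the end of the word. The sentinel
    that closes the record positions of p is the position of M, so the other
    parts are those of p. *)
Lemma record_composition_max p M q :
  all (ltn^~ M) p -> all (ltn^~ M) q ->
  record_composition (p ++ M :: q) = rcons (record_composition p) (size q).+1.
Proof.
move=> pM qM; rewrite /record_composition record_positions_max //.
set R := record_positions p; rewrite size_rcons -[(size R).+1]addn1 iotaD map_cat cats1.
congr rcons.
  apply/eq_in_map => j; rewrite mem_iota => lej; rewrite /entry.
  by rewrite !(nth_rcons _ (rcons _ _)) size_rcons; do 2 (case: ltnP => ?; last lia).
rewrite /entry add1n /= !nth_rcons !size_rcons !ltnn !eqxx ltnS leqnn.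
by rewrite size_cat /=; lia.
Qed.

(** * The recurrence and the product formula *)

Lemma zigzag_record_composition_max p M q alpha m k :
  all (ltn^~ M) p -> all (ltn^~ M) q -> size p + size q = 2 * m + (2 * k).+1 ->
  zigzag false (p ++ M :: q) &&
    (record_composition (peaks (p ++ M :: q)) == rcons alpha k.+1) =
  [&& size p == 2 * m,
      zigzag false p && (record_composition (peaks p) == alpha)
    & zigzag true q].
Proof.
move=> pM qM szpq; rewrite zigzag_max //.
have [oddp | evp] := boolP (odd (size p)).
  by have -> : (size p == 2 * m) = false by lia.
have oddq : odd (size q) by lia.
rewrite peaks_max // record_composition_max; last 2 first.
- apply/(all_nthP 0) => i; rewrite size_peaks => lti; rewrite nth_peaks //.
  by apply: (all_nthP 0 pM); lia.
- apply/allP => x /mapP[i]; rewrite mem_iota => lti ->.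
  by apply: (all_nthP 0 qM); lia.
rewrite eqseq_rcons size_map size_iota.
have -> : ((size q)./2.+1 == k.+1) = (size p == 2 * m) by lia.
by case: (_ == 2 * m); case: zigzag; case: zigzag; case: (_ == alpha).
Qed.

Lemma oneline_split_max N (w : 'S_N.+1) :
  exists p q, [/\ oneline w = p ++ N.+1 :: q,
                  all (ltn^~ N.+1) p & all (ltn^~ N.+1) q].
Proof.
pose i := (w^-1)%g ord_max.
have [s ws] : exists s, w = lift_perm i ord_max s.
  by apply: lift_perm_surj; rewrite permKV.
have : all (ltn^~ N.+1) (oneline s).
  by rewrite all_map; apply/allP => j _; rewrite /= ltnS.
rewrite -{1}(cat_take_drop i (oneline s)) all_cat => /andP[sp sq].
exists (take i (oneline s)), (drop i (oneline s)); split=> //.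
by rewrite {1}ws oneline_lift_max.
Qed.

Lemma num_alt_rcE n alpha :
  num_alt_rc n alpha =
    count_perms (2 * n) (fun s => zigzag false s &&
                           (record_composition (peaks s) == alpha)).
Proof.
apply: eq_card => w; rewrite !inE /alternating /zigzag size_oneline.
congr (_ && (record_composition _ == _)).
  by apply: eq_all => i; rewrite addbF.
by rewrite /hat /peaks size_oneline (_ : (2 * n)./2 = n) //; lia.
Qed.

Lemma num_alt_rc_rcons m k alpha :
  num_alt_rc (m + k.+1) (rcons alpha k.+1) =
    'C(2 * m + (2 * k).+1, 2 * m) *
      (num_alt_rc m alpha * euler (2 * k).+1).
Proof.
rewrite !num_alt_rcE -count_zigzag_true -count_perms_max; last 2 first.
- move=> s t st; rewrite (zigzag_same_order _ st).
  by rewrite (record_composition_same_order (peaks_same_order st)).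
- exact: zigzag_same_order.
rewrite (_ : 2 * (m + k.+1) = (2 * m + (2 * k).+1).+1); last by lia.
apply: eq_count_perms => w; have szw := size_oneline w.
have [p [q [wE pM qM]]] := oneline_split_max w.
rewrite wE size_cat /= addnS in szw; case: szw => szw.
rewrite wE (zigzag_record_composition_max _ pM qM szw).
have -> : (nth 0 (p ++ (2 * m + (2 * k).+1).+1 :: q) (2 * m) ==
           (2 * m + (2 * k).+1).+1) = (size p == 2 * m).
  rewrite nth_cat; case: (ltngtP (size p) (2 * m)) => [ltp|gtp|->].
  - rewrite -subnSK //=; set j := _ - _.
    have ltj : j < size q by rewrite /j; lia.
    exact: ltn_eqF (all_nthP 0 qM j ltj).
  - exact: ltn_eqF (all_nthP 0 pM _ gtp).
  - by rewrite subnn eqxx.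
case: eqP => //= szp.
by rewrite -szp take_size_cat // -cat_rcons drop_size_cat ?size_rcons.
Qed.

(** The empty word, with the empty composition, starts the induction. *)
Lemma num_alt_rc0 : num_alt_rc 0 [::] = 1.
Proof.
rewrite /num_alt_rc; have -> : [set w in alt_perms (2 * 0) |
    record_composition (hat w) == [::]] = setT by apply/setP => w; rewrite !inE.
by rewrite cardsT card_Sn.
Qed.

Lemma partial_sum_sumn alpha : partial_sum alpha (size alpha) = sumn alpha.
Proof.
by rewrite sumnE [RHS](big_nth 0) /partial_sum big_add1.
Qed.

Local Open Scope ring_scope.

Lemma num_alt_rc_prod n alpha :
  is_composition n alpha ->
  (num_alt_rc n alpha)%:R = ((2 * n)`!)%:R *
    \prod_(1 <= j < (size alpha).+1)
       (bcoef (entry alpha j) / (partial_sum alpha j)%:R).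
Proof.
elim/last_ind: alpha n => [|alpha k IHalpha] n /andP[/eqP <-].
  by rewrite big_nil num_alt_rc0 mulr1.
rewrite all_rcons => /andP[]; case: k => // k _ alpha_gt0.
rewrite sumn_rcons; set m := sumn alpha.
rewrite size_rcons big_nat_recr //= num_alt_rc_rcons !natrM IHalpha; last first.
  by rewrite /is_composition eqxx.
under [in RHS]eq_big_nat => j lej.
  have -> : entry (rcons alpha k.+1) j = entry alpha j.
    by rewrite /entry nth_rcons; case: ltnP => //; lia.
  have -> : partial_sum (rcons alpha k.+1) j = partial_sum alpha j.
    rewrite /partial_sum; apply: eq_big_nat => i lei.
    by rewrite /entry nth_rcons; case: ltnP => //; lia.
  over.
rewrite -(size_rcons alpha k.+1) partial_sum_sumn sumn_rcons -/m.
set A := \prod_(_ <= _ < _) _.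
rewrite /entry size_rcons /= nth_rcons ltnn eqxx /bcoef.
have -> : (2 * k.+1 - 1 = (2 * k).+1)%N by lia.
have -> : (2 * (m + k.+1) = (2 * m + (2 * k).+1).+1)%N by lia.
have -> : (2 * k.+1 = (2 * k).+2)%N by lia.
have /(congr1 (fun x : nat => x%:R : rat)) :=
  @bin_fact (2 * m + (2 * k).+1) (2 * m) (leq_addr _ _).
rewrite addKn !factS !natrM => <-.
have nz j : (j.+1)%:R != 0 :> rat by rewrite Num.Theory.pnatr_eq0.
have fnz j : j`!%:R != 0 :> rat by rewrite Num.Theory.pnatr_eq0 -lt0n fact_gt0.
have -> : ((2 * m + (2 * k).+1).+1%:R = 2 * (m + k.+1)%:R :> rat).
  by rewrite -natrM; congr _%:R; lia.
have -> : ((2 * k).+2%:R = 2 * k.+1%:R :> rat).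
  by rewrite -natrM; congr _%:R; lia.
have nzmk : (m + k.+1)%:R != 0 :> rat by rewrite addnS.
(* Naming the factors keeps [field] from expanding the sums inside the casts. *)
move: nzmk (nz k) (nz (2 * k)%N) (fnz (2 * k)%N).
move: (m + k.+1)%:R k.+1%:R (2 * k).+1%:R (2 * k)`!%:R => x y z t x0 y0 z0 t0.
by field; rewrite x0 y0 z0 t0.
Qed.

Theorem theorem1p2 (n : nat) (alpha : seq nat)
    (n_ge1 : (1 <= n)%N) (alphaP : is_composition n alpha) :
  (num_alt_rc n alpha)%:R =
    ((2 * n)`!)%:R *
    \prod_(1 <= j < (size alpha).+1)
       (bcoef (entry alpha j) / (partial_sum alpha j)%:R)
  /\
  ((2 * n)`!)%:R *
    \prod_(1 <= j < (size alpha).+1)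
       (bcoef (entry alpha j) / (partial_sum alpha j)%:R)
  = ((2 * n)`!)%:R *
    ((\prod_(1 <= j < (size alpha).+1) bcoef (entry alpha j)) /
       (pi_u alpha)%:R).
Proof.
split; first exact: num_alt_rc_prod.
by rewrite prodf_div /pi_u natr_prod.
Qed.
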